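(* Let $n\ge 2$ be an integer, let $x_1\le x_2\le\cdots\le x_n$ be real numbers that are not all equal, and let $p\ge 1$ be a real number. Then $$\frac{n-2}{2^{p-1}}+1\;\le\;\frac{\sum_{1\le i<j\le n}|x_i-x_j|^p}{|x_n-x_1|^p}\;\le\;\begin{cases}\dfrac{n^2}{4}, & \text{if } n \text{ is even},\\[2mm] \dfrac{n^2-1}{4}, & \text{if } n \text{ is odd}.\end{cases}$$ Moreover: (a) The upper bound is achieved (i.e. the right-hand inequality is an equality) in the following cases: (i) $n=2m$ with $m\ge 1$ and $x_1=\cdots=x_m<x_{m+1}=\cdots=x_n$; (ii) $n=2m+1$ and either $x_1=\cdots=x_{m+1}<x_{m+2}=\cdots=x_n$ or $x_1=\cdots=x_m<x_{m+1}=\cdots=x_n$. (b) The lower bound is achieved (i.e. the left-hand inequality is an equality) when $x_1<x_2=\cdots=x_{n-1}<x_n$ and $x_2=\cdots=x_{n-1}=\frac{x_1+x_n}{2}$.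
   Context: In (b), the condition means $x_1<x_n$ and $x_i=\frac{x_1+x_n}{2}$ for every $i$ with $2\le i\le n-1$; for $n=2$ there are no such indices $i$ and the condition is just $x_1<x_2$. *)

(* Defs.v *)
From HB Require Import structures.
From mathcomp Require Import all_boot all_order all_algebra.
From mathcomp Require Import reals exp.
Set Implicit Arguments.
Unset Strict Implicit.
Unset Printing Implicit Defensive.
Import Order.TTheory GRing.Theory Num.Theory.
Local Open Scope ring_scope.

(* Indices are zero-based: x_k of the usual x_1, ..., x_n is x at the ordinal
   of value k - 1. *)
Definition ord_first (n : nat) (hn : (2 <= n)%N) : 'I_n := Ordinal (ltnW hn).

Lemma ord_last_subproof (n : nat) (hn : (2 <= n)%N) : (n.-1 < n)%N.
Proof. by case: n hn. Qed.

Definition ord_last (n : nat) (hn : (2 <= n)%N) : 'I_n :=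
  Ordinal (ord_last_subproof hn).

Definition pairs_sum (R : realType) (n : nat) (p : R) (x : 'I_n -> R) : R :=
  \sum_(i < n) \sum_(j < n | (i < j)%N) `|x i - x j| `^ p.

Definition spread_ratio (R : realType) (n : nat) (hn : (2 <= n)%N) (p : R)
    (x : 'I_n -> R) : R :=
  pairs_sum p x / `|x (ord_last hn) - x (ord_first hn)| `^ p.

Definition ratio_lower (R : realType) (n : nat) (p : R) : R :=
  (n%:R - 2) / 2 `^ (p - 1) + 1.

Definition ratio_upper (R : realType) (n : nat) : R :=
  if odd n then (n%:R ^+ 2 - 1) / 4 else n%:R ^+ 2 / 4.

(* x_1 = ... = x_k < x_{k+1} = ... = x_n, for 1 <= k < n *)
Definition jumps_after (R : realType) (n : nat) (x : 'I_n -> R) (k : nat) :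
    Prop :=
  [/\ forall i j : 'I_n, (i < k)%N -> (j < k)%N -> x i = x j,
      forall i j : 'I_n, (k <= i)%N -> (k <= j)%N -> x i = x j
    & forall i j : 'I_n, (i < k)%N -> (k <= j)%N -> x i < x j].

Definition midpoint_config (R : realType) (n : nat) (hn : (2 <= n)%N)
    (x : 'I_n -> R) : Prop :=
  x (ord_first hn) < x (ord_last hn) /\
  forall i : 'I_n, (0 < i)%N -> (i < n.-1)%N ->
    x i = (x (ord_first hn) + x (ord_last hn)) / 2.

(* Main.v *)
Require Import Defs.
From HB Require Import structures.
From mathcomp Require Import all_boot all_order all_algebra.
From mathcomp Require Import zify ring lra.
From mathcomp Require Import classical_sets interval_inference convex hoelder.
From mathcomp Require Import reals exp.
From mathcomp Require unstable.
Set Implicit Arguments.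
Unset Strict Implicit.
Unset Printing Implicit Defensive.
Import Order.TTheory GRing.Theory Num.Theory.
Local Open Scope ring_scope.

(** Remove the two extreme points from a sorted family and let d be their
distance.  An interior point at distances a and b from them satisfies
a + b = d and contributes a^p + b^p to the pairs that involve an extreme point;
since p >= 1,

    2 (d/2)^p <= a^p + b^p <= d^p,

by convexity on the left ([powR_midpoint_convex]) and superadditivity on the
right ([powR_superadditive]).  [pairs_sum_outer] splits the sum over all pairs
into d^p for the extreme pair, these contributions of the n - 2 interior points,
and the sum over interior pairs.

For the lower bound, drop the sum over interior pairs: d^p + (n-2) 2 (d/2)^p is
the claimed bound times d^p.  When all interior points sit at the midpoint, both
estimates are equalities, which is the equality case (b).

For the upper bound, induct on n by steps of two: the pairs that involve an
extreme point contribute at most (n-1) d^p, and the interior points lie in an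
interval of length at most d, so their sum is at most the bound for n - 2.  The
bound itself grows by exactly n - 1 from n - 2 to n ([ratio_upperSS]).

For the equality case (a), a family with a single jump after its first k points
has exactly k (n - k) pairs at nonzero distance, all at distance d; taking k to
be half of n, rounded either way, gives the upper bound. *)

(** * Inequalities between powers *)

(** The graph of the power lies below its chord from 0 to d, as
a^(p-1) <= d^(p-1). *)
Lemma powR_chord (R : realType) (p a d : R) :
  1 <= p -> 0 <= a <= d -> a `^ p <= a * d `^ (p - 1).
Proof.
move=> p_ge1 /andP[a_ge0 a_le_d].
rewrite -mulr_powRB1 ?(lt_le_trans _ p_ge1)//.
apply: ler_wpM2l => //.
by apply: ge0_ler_powR; rewrite ?nnegrE ?subr_ge0 ?(le_trans a_ge0).
Qed.

(** Add the chord bounds of a and of b on the segment from 0 to a + b. *)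
Lemma powR_superadditive (R : realType) (p a b : R) :
  1 <= p -> 0 <= a -> 0 <= b -> a `^ p + b `^ p <= (a + b) `^ p.
Proof.
move=> p_ge1 a_ge0 b_ge0.
rewrite -[leRHS]mulr_powRB1 ?addr_ge0 ?(lt_le_trans _ p_ge1)// mulrDl.
by apply: lerD; apply: powR_chord; rewrite // ?a_ge0 ?b_ge0 ?lerDl ?lerDr.
Qed.

(** Passes between the form of the constant suited to convexity at the midpoint
and the one in [ratio_lower]. *)
Lemma powR_half (R : realType) (p d : R) :
  1 <= p -> 0 <= d -> (d / 2) `^ p *+ 2 = d `^ p / 2 `^ (p - 1).
Proof.
move=> p_ge1 d_ge0.
have two_gt0 : 0 < 2 `^ (p - 1) :> R by rewrite powR_gt0.
apply: (mulIf (lt0r_neq0 two_gt0)); rewrite mulfVK ?lt0r_neq0//.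
rewrite -mulr_natl mulrAC mulr_powRB1 ?(lt_le_trans _ p_ge1)//.
by rewrite -powRM ?divr_ge0// mulrCA mulfV ?mulr1// pnatr_eq0.
Qed.

Lemma powR_midpoint_convex (R : realType) (p a b : R) :
  1 <= p -> 0 <= a -> 0 <= b ->
  (a + b) `^ p / 2 `^ (p - 1) <= a `^ p + b `^ p.
Proof.
move=> p_ge1 a_ge0 b_ge0.
have half_ge0 : 0 <= 2^-1 :> R by lra.
have half_le1 : 2^-1 <= 1 :> R by lra.
have := convex_powR p_ge1 (Itv01 half_ge0 half_le1) (x := a) (y := b).
rewrite !inE /= !in_itv /= !andbT => /(_ a_ge0 b_ge0).
rewrite !convRE /= /unstable.onem => conv.
rewrite -powR_half ?addr_ge0//.
suff -> : (a + b) / 2 = 2^-1 * a + (1 - 2^-1) * b by lra.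
by lra.
Qed.

(** * Removing the two extreme points *)

Definition interior (N : nat) (i : 'I_N) : 'I_N.+2 :=
  lift ord0 (widen_ord (leqnSn N) i).

(** Stated for an arbitrary summand since the argument is one about index sets
only: row 0 has no column 0, the last row is empty, and each interior row
consists of the interior columns followed by the last one. *)
Lemma sum_pairs_outer (V : nmodType) (N : nat) (F : 'I_N.+2 -> 'I_N.+2 -> V) :
  \sum_(i < N.+2) \sum_(j < N.+2 | (i < j)%N) F i j =
  F ord0 ord_max + \sum_(i < N) (F ord0 (interior i) + F (interior i) ord_max)
  + \sum_(i < N) \sum_(j < N | (i < j)%N) F (interior i) (interior j).
Proof.
have last_lift : lift ord0 ord_max = ord_max :> 'I_N.+2 by exact: val_inj.
have row0 : \sum_(j < N.+2 | (@ord0 N.+1 < j)%N) F ord0 j =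
    \sum_(i < N) F ord0 (interior i) + F ord0 ord_max.
  by rewrite big_mkcond big_ord_recl big_ord_recr /= add0r last_lift.
have row_last : \sum_(j < N.+2 | (@ord_max N.+1 < j)%N) F ord_max j = 0.
  by apply: big_pred0 => j; rewrite ltnNge -ltnS ltn_ord.
have row_interior (i : 'I_N) :
    \sum_(j < N.+2 | (interior i < j)%N) F (interior i) j =
    \sum_(j < N | (i < j)%N) F (interior i) (interior j)
    + F (interior i) ord_max.
  rewrite big_mkcond big_ord_recl big_ord_recr /= add0r last_lift.
  by rewrite /bump /= ltnS ltn_ord [in RHS]big_mkcond.
rewrite big_ord_recl big_ord_recr /= last_lift row0 row_last addr0.
rewrite (eq_bigr _ (fun i _ => row_interior i)) !big_split /=.
by rewrite [X in X + _ = _]addrC [X in _ + X = _]addrC !addrA.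
Qed.

(** Distances are oriented so that they lose their absolute value when x is
sorted. *)
Lemma pairs_sum_outer (R : realType) (N : nat) (p : R) (x : 'I_N.+2 -> R) :
  pairs_sum p x =
  `|x ord_max - x ord0| `^ p
  + \sum_(i < N) (`|x (interior i) - x ord0| `^ p
                  + `|x ord_max - x (interior i)| `^ p)
  + pairs_sum p (x \o @interior N).
Proof.
rewrite /pairs_sum sum_pairs_outer distrC; congr (_ + _ + _).
by apply: eq_bigr => i _; rewrite distrC [X in _ + X `^ _]distrC.
Qed.

Lemma pairs_sum_ge0 (R : realType) (n : nat) (p : R) (x : 'I_n -> R) :
  0 <= pairs_sum p x.
Proof. by do 2!apply: sumr_ge0 => ? _; apply: powR_ge0. Qed.

(** * The two bounds *)

Lemma ratio_upperSS (R : realType) (n : nat) :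
  ratio_upper R n.+2 = 1 + n%:R + ratio_upper R n.
Proof.
rewrite /ratio_upper /= negbK -[n.+2]addn2 natrD.
by case: (odd n); field.
Qed.

(** The bound is in terms of an enclosing interval [a, b] and not of the range
of x: the induction hypothesis then applies to the interior points with the same
power of b - a, and the case of no points, where the induction starts, makes
sense. *)
Lemma pairs_sum_le (R : realType) (p : R) : 1 <= p ->
  forall (n : nat) (x : 'I_n -> R) (a b : R),
  {homo x : i j / (i <= j)%N >-> i <= j} -> (forall i, a <= x i <= b) ->
  pairs_sum p x <= ratio_upper R n * (b - a) `^ p.
Proof.
move=> p_ge1; elim/ltn_ind => -[|[|n]] IH x a b x_sorted x_ab.
- by rewrite /pairs_sum big_ord0 /ratio_upper/= expr0n !mul0r.
- rewrite /pairs_sum big_ord1 big_pred0 => [|j]; last by rewrite (ord1 j).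
  by rewrite /ratio_upper/= expr1n subrr !mul0r.
rewrite pairs_sum_outer ratio_upperSS !mulrDl mul1r; apply: lerD.
  (* the n.+1 pairs with an extreme point contribute at most 1 + n times the
     power of the length *)
  have range_le : `|x ord_max - x ord0| `^ p <= (b - a) `^ p.
    have /andP[a_x0 _] := x_ab ord0; have /andP[_ x_b] := x_ab ord_max.
    have x0_xmax := x_sorted ord0 ord_max isT.
    rewrite ger0_norm ?subr_ge0//.
    by apply: ge0_ler_powR; rewrite ?nnegrE; lra.
  apply: lerD => //.
  rewrite mulr_natl -[X in _ *+ X]card_ord -sumr_const.
  apply: ler_sum => i _; apply: le_trans range_le.
  have x0_xi := x_sorted ord0 (interior i) isT.
  have xi_xmax : x (interior i) <= x ord_max by apply: x_sorted; rewrite -ltnS.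
  rewrite !ger0_norm ?subr_ge0 ?(le_trans x0_xi)//.
  apply: le_trans (powR_superadditive _ _ _) _; rewrite ?subr_ge0//.
  by rewrite addrC addrA subrK.
apply: IH => // [i j i_le_j|i]; last exact: x_ab.
exact: x_sorted.
Qed.

Lemma pairs_sum_ge (R : realType) (N : nat) (p : R) (x : 'I_N.+2 -> R) :
  1 <= p -> {homo x : i j / (i <= j)%N >-> i <= j} ->
  ratio_lower N.+2 p * (x ord_max - x ord0) `^ p <= pairs_sum p x.
Proof.
move=> p_ge1 x_sorted; rewrite pairs_sum_outer.
rewrite ler_wpDr ?pairs_sum_ge0// /ratio_lower mulrDl mul1r addrC.
rewrite ger0_norm ?subr_ge0 ?x_sorted// lerD2l.
rewrite -[N.+2]addn2 natrD addrK -mulrA mulrC mulr_natr.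
rewrite -[X in _ *+ X]card_ord -sumr_const.
apply: ler_sum => i _.
have x0_xi := x_sorted ord0 (interior i) isT.
have xi_xmax : x (interior i) <= x ord_max by apply: x_sorted; rewrite -ltnS.
rewrite !ger0_norm ?subr_ge0// [X in X <= _]mulrC.
rewrite (_ : x ord_max - x ord0 =
  (x (interior i) - x ord0) + (x ord_max - x (interior i))); last by ring.
by apply: powR_midpoint_convex; rewrite ?subr_ge0.
Qed.

Lemma pairs_sum_midpoints (R : realType) (N : nat) (p : R) (x : 'I_N.+2 -> R) :
  1 <= p -> x ord0 <= x ord_max ->
  (forall i, x (interior i) = (x ord0 + x ord_max) / 2) ->
  pairs_sum p x = ratio_lower N.+2 p * (x ord_max - x ord0) `^ p.
Proof.
move=> p_ge1 x0_xmax x_mid; rewrite pairs_sum_outer.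
have p_neq0 : p != 0 by rewrite gt_eqF// (lt_le_trans _ p_ge1).
have -> : pairs_sum p (x \o @interior N) = 0.
  by do 2!apply: big1 => ? _; rewrite /= !x_mid subrr normr0 powR0.
rewrite addr0 /ratio_lower mulrDl mul1r addrC ger0_norm ?subr_ge0//.
congr (_ + _); rewrite -[N.+2]addn2 natrD addrK -mulrA mulr_natl.
rewrite -[X in _ *+ X]card_ord -sumr_const; apply: eq_bigr => i _.
rewrite x_mid !ger0_norm; [|lra..].
rewrite [RHS]mulrC -powR_half ?subr_ge0// mulr2n.
by congr (_ `^ _ + _ `^ _); field.
Qed.

(** * Families with a single jump *)

Lemma sum_ord_lt (R : pzSemiRingType) (n k : nat) : (k <= n)%N ->
  \sum_(i < n) (i < k)%:R = k%:R :> R.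
Proof.
move=> k_le_n.
have <- : \sum_(i < k) (1 : R) = k%:R by rewrite sumr_const card_ord.
rewrite (big_ord_widen _ (fun=> 1) k_le_n) [RHS]big_mkcond.
by apply: eq_bigr => i _; case: ltnP.
Qed.

Lemma sum_ord_ge (R : pzRingType) (n k : nat) : (k <= n)%N ->
  \sum_(i < n) (k <= i)%:R = (n - k)%:R :> R.
Proof.
move=> k_le_n; rewrite natrB// -(sum_ord_lt R k_le_n).
rewrite -[X in X%:R - _]card_ord -sumr_const -sumrB.
by apply: eq_bigr => i _; rewrite leqNgt; case: ltnP; rewrite ?subr0 ?subrr.
Qed.

(** The pairs that contribute are those in the product of the first k indices
with the remaining ones; such pairs satisfy i < j automatically, so the sum of
their indicators factors.  Any i0 and i1 on either side of the jump give the
common distance. *)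
Lemma pairs_sum_jump (R : realType) (n k : nat) (p : R) (x : 'I_n -> R)
    (i0 i1 : 'I_n) :
  p != 0 -> (k <= n)%N -> (i0 < k <= i1)%N -> jumps_after x k ->
  pairs_sum p x = (k * (n - k))%:R * `|x i1 - x i0| `^ p.
Proof.
move=> p_neq0 k_le_n /andP[i0_lt_k k_le_i1] [x_low x_high _].
rewrite natrM -(sum_ord_lt R k_le_n) -(sum_ord_ge R k_le_n).
rewrite [X in X * _]mulr_suml [RHS]mulr_suml; apply: eq_bigr => i _.
rewrite mulr_sumr mulr_suml big_mkcond; apply: eq_bigr => j _.
case: (ltnP i k) (ltnP j k) => [i_lt_k|k_le_i] [j_lt_k|k_le_j] /=.
- rewrite mulr0 mul0r (x_low i j)// subrr normr0 powR0//.
  by case: ifP.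
- rewrite (leq_trans i_lt_k k_le_j) !mul1r distrC.
  by rewrite (x_low i i0)// (x_high j i1).
- by rewrite ltnNge ltnW ?(leq_trans j_lt_k)// !mul0r.
- rewrite !mul0r (x_high i j)// subrr normr0 powR0//.
  by case: ifP.
Qed.

Lemma spread_ratio_jump (R : realType) (n : nat) (hn : (2 <= n)%N) (k : nat)
    (p : R) (x : 'I_n -> R) :
  p != 0 -> (0 < k < n)%N -> jumps_after x k ->
  spread_ratio hn p x = (k * (n - k))%:R.
Proof.
move=> p_neq0 /andP[k_gt0 k_lt_n] x_jumps.
have k_le_last : (k <= ord_last hn)%N by rewrite /= -ltnS prednK ?(ltnW hn).
have [_ _ /(_ (ord_first hn) (ord_last hn) k_gt0 k_le_last) x0_lt] := x_jumps.
have k_between : (ord_first hn < k <= ord_last hn)%N by rewrite k_gt0.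
rewrite /spread_ratio (pairs_sum_jump p_neq0 (ltnW k_lt_n) k_between x_jumps).
by rewrite mulfK// gt_eqF// powR_gt0// normr_gt0 subr_eq0 gt_eqF.
Qed.

(** * Bounds and equality cases of the ratio *)

Theorem theorem2p1 (R : realType) (n : nat) (hn : (2 <= n)%N)
    (x : 'I_n -> R) (x_sorted : forall i j : 'I_n, (i <= j)%N -> x i <= x j)
    (x_not_const : ~ (forall i j : 'I_n, x i = x j))
    (p : R) (hp : 1 <= p) :
  (ratio_lower n p <= spread_ratio hn p x /\
   spread_ratio hn p x <= ratio_upper R n) /\
  ((forall m : nat, (1 <= m)%N -> n = (2 * m)%N -> jumps_after x m ->
      spread_ratio hn p x = ratio_upper R n) /\
   (forall m : nat, n = (2 * m + 1)%N ->
      jumps_after x m.+1 \/ jumps_after x m ->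
      spread_ratio hn p x = ratio_upper R n)) /\
  (midpoint_config hn x -> spread_ratio hn p x = ratio_lower n p).
Proof.
have p_neq0 : p != 0 by rewrite gt_eqF// (lt_le_trans _ hp).
split; last split.
- case: n hn x x_sorted x_not_const => [|[|N]]// hn x x_sorted x_not_const.
  rewrite /spread_ratio.
  have -> : ord_first hn = ord0 by exact: val_inj.
  have -> : ord_last hn = ord_max by exact: val_inj.
  have x_range i : x ord0 <= x i <= x ord_max.
    by rewrite !x_sorted// -ltnS.
  have x0_lt_xmax : x ord0 < x ord_max.
    rewrite lt_neqAle x_sorted// andbT; apply/eqP => x0_eq.
    apply: x_not_const.
    suff x_const i : x i = x ord0 by move=> i j; rewrite !x_const.
    by apply: le_anti; rewrite {1}x0_eq andbC; apply: x_range.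
  rewrite ger0_norm ?subr_ge0 ?x_sorted//.
  have range_gt0 : 0 < (x ord_max - x ord0) `^ p by rewrite powR_gt0 ?subr_gt0.
  rewrite ler_pdivlMr// ler_pdivrMr//; split; first exact: pairs_sum_ge.
  exact: pairs_sum_le.
- split=> m.
    move=> m_gt0 n_eq x_jumps.
    rewrite (spread_ratio_jump hn p_neq0 _ x_jumps); last by lia.
    rewrite /ratio_upper (_ : (n - m = m)%N); last by lia.
    by rewrite n_eq oddM/= !natrM; field.
  move=> n_eq x_jumps.
  have -> : spread_ratio hn p x = (m * m.+1)%:R.
    case: x_jumps => x_jumps.
      rewrite (spread_ratio_jump hn p_neq0 _ x_jumps); last by lia.
      by congr _%:R; lia.
    rewrite (spread_ratio_jump hn p_neq0 _ x_jumps); last by lia.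
    by congr _%:R; lia.
  rewrite /ratio_upper n_eq oddD oddM/= natrD !natrM -[m.+1]addn1 natrD.
  by field.
- case: n hn x x_sorted x_not_const => [|[|N]]// hn x x_sorted x_not_const.
  rewrite /midpoint_config /spread_ratio.
  have -> : ord_first hn = ord0 by exact: val_inj.
  have -> : ord_last hn = ord_max by exact: val_inj.
  case=> x0_lt_xmax x_mid.
  rewrite (pairs_sum_midpoints hp (ltW x0_lt_xmax)) => [|i].
    by rewrite ger0_norm ?subr_ge0 ?ltW// mulfK// gt_eqF// powR_gt0// subr_gt0.
  by apply: x_mid => //=; rewrite /bump /= add1n ltnS.
Qed.
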